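(* Let $A$ and $V$ be two Jordan algebras over $k$ and let $\triangleleft : V\times A \to V$, $\triangleright : V \times A \to A$ be two bilinear maps. Then the multiplication on the vector space $A\times V$ defined for all $a,b\in A$ and $x,y\in V$ by $$(a, x) \circ (b, y) := \bigl( a b + x \triangleright b + y\triangleright a , \ x\triangleleft b + y\triangleleft a + x y \bigr)$$ is a Jordan algebra structure on $A \times V$ if and only if $(A, V, \triangleleft, \triangleright)$ is a matched pair of Jordan algebras.
   Context: Throughout, $k$ is a field of characteristic $\neq 2$ and all vector spaces and (bi)linear maps are over $k$. A Jordan algebra is a vector space $A$ with a bilinear multiplication (written by juxtaposition) which is commutative, $ab=ba$, and satisfies the Jordan identity $(a^2 b)a = a^2(ba)$ for all $a,b\in A$ (no unit is required; here $a^2=aa$). A right action of a Jordan algebra $A$ on a vector space $M$ is a bilinear map $\triangleleft : M\times A\to M$ with $(x\triangleleft a^2)\triangleleft a = (x\triangleleft a)\triangleleft a^2$ for all $a\in A$, $x\in M$. A left action of $A$ on $M$ is a bilinear map $\triangleright : A\times M\to M$ with $a\triangleright(a^2\triangleright x)=a^2\triangleright(a\triangleright x)$ for all $a\in A$, $x\in M$. Let $A$, $V$ be Jordan algebras. A quadruple $(A,V,\triangleleft,\triangleright)$ is a matched pair of Jordan algebras if $\triangleleft: V\times A\to V$ is a right action of the Jordan algebra $A$ on $V$, $\triangleright: V\times A\to A$ is a left action of the Jordan algebra $V$ on $A$, and for all $a,b\in A$, $x,y\in V$ (in expressions such as $x^2y\triangleleft a$, $xy\triangleright a$, $x\triangleleft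 ba$, the juxtaposition products are performed before the actions): (MP1) $a(x\triangleright a^2)+(x\triangleleft a^2)\triangleright a = a^2(x\triangleright a)+(x\triangleleft a)\triangleright a^2$; (MP2) $x\triangleleft(x^2\triangleright a)+(x^2\triangleleft a)x = x^2\triangleleft(x\triangleright a)+x^2(x\triangleleft a)$; (MP3) $2\bigl[((x\triangleleft a)\triangleleft b)\triangleleft a + x\triangleleft((x\triangleright a)b)+x\triangleleft((x\triangleleft a)\triangleright b)+((x\triangleleft a)\triangleleft b)x\bigr]+(x^2\triangleleft b)\triangleleft a + x\triangleleft(ba^2) = 2\bigl[(x\triangleleft a)\triangleleft (ba)+(x\triangleleft a)\triangleleft(x\triangleright b)+(x\triangleleft b)\triangleleft(x\triangleright a)+(x\triangleleft a)(x\triangleleft b)\bigr]+x^2\triangleleft (ba)+(x\triangleleft b)\triangleleft a^2$; (MP4) $2\bigl[(y\triangleright(x\triangleright a))a + x\triangleright(y\triangleright(x\triangleright a))+(y\triangleleft(x\triangleright a))\triangleright a+((x\triangleleft a)y)\triangleright a\bigr]+(x^2y)\triangleright a+x\triangleright(y\triangleright a^2) = 2\bigl[(y\triangleright a)(x\triangleright a)+(xy)\triangleright(x\triangleright a)+(y\triangleleft a)\triangleright(x\triangleright a)+(x\triangleleft a)\triangleright(y\triangleright a)\bigr]+x^2\triangleright(y\triangleright a)+(xy)\triangleright a^2$; (MP5) $2\bigl[(y\triangleleft(x\triangleright a))\triangleleft a+((x\triangleleft a)y)\triangleleft a+x\triangleleft(y\triangleright(x\triangleright a))+(y\triangleleft(x\triangleright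 a))x+((x\triangleleft a)y)x\bigr]+(x^2y)\triangleleft a+x\triangleleft(y\triangleright a^2)+(y\triangleleft a^2)x = 2\bigl[(x\triangleleft a)\triangleleft(y\triangleright a)+(y\triangleleft a)\triangleleft(x\triangleright a)+(xy)\triangleleft(x\triangleright a)+(x\triangleleft a)(xy)+(x\triangleleft a)(y\triangleleft a)\bigr]+x^2\triangleleft(y\triangleright a)+(xy)\triangleleft a^2+x^2(y\triangleleft a)$; (MP6) $2\bigl[((x\triangleright a)b)a+((x\triangleleft a)\triangleright b)a+((x\triangleleft a)\triangleleft b)\triangleright a+x\triangleright((x\triangleright a)b)+x\triangleright((x\triangleleft a)\triangleright b)\bigr]+(x^2\triangleright b)a+(x^2\triangleleft b)\triangleright a+x\triangleright(a^2b) = 2\bigl[(x\triangleright a)(ab)+(x\triangleleft a)\triangleright(ba)+(x\triangleright a)(x\triangleright b)+(x\triangleleft b)\triangleright(x\triangleright a)+(x\triangleleft a)\triangleright(x\triangleright b)\bigr]+x^2\triangleright(ba)+(x\triangleleft b)\triangleright a^2+a^2(x\triangleright b)$. *)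

(* Defs.v *)
From mathcomp Require Import all_boot all_algebra.

Set Implicit Arguments.
Unset Strict Implicit.
Unset Printing Implicit Defensive.

Import GRing.Theory.
Local Open Scope ring_scope.

Notation bilinear_map f := (bilinear_for *:%R *:%R f).

(* Jordan algebras are possibly infinite-dimensional and non-unital. *)
Definition jordan_algebra (k : fieldType) (A : lmodType k)
    (mul : A -> A -> A) : Prop :=
  [/\ bilinear_map mul,
      commutative mul &
      forall a b, mul (mul (mul a a) b) a = mul (mul a a) (mul b a)].

Definition right_action (k : fieldType) (A M : lmodType k)
    (mul : A -> A -> A) (act : M -> A -> M) : Prop :=
  bilinear_map act /\
  forall (a : A) (x : M),
    act (act x (mul a a)) a = act (act x a) (mul a a).

Definition left_action (k : fieldType) (A M : lmodType k)
    (mul : A -> A -> A) (act : A -> M -> M) : Prop :=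
  bilinear_map act /\
  forall (a : A) (x : M),
    act a (act (mul a a) x) = act (mul a a) (act a x).

Section MatchedPair.

Variables (k : fieldType) (A V : lmodType k).
Variables (mulA : A -> A -> A) (mulV : V -> V -> V).
Variables (ract : V -> A -> V) (lact : V -> A -> A).

(* Products bind tighter than actions, and actions tighter than sums. *)
Local Notation "a ⋅ b" := (mulA a b) (at level 40, left associativity).
Local Notation "x ⋆ y" := (mulV x y) (at level 40, left associativity).
Local Notation "x ◁ a" := (ract x a) (at level 45, no associativity).
Local Notation "x ▷ a" := (lact x a) (at level 45, no associativity).

Record matched_pair : Prop := MatchedPair {
  mp_jordanA : jordan_algebra mulA;
  mp_jordanV : jordan_algebra mulV;
  mp_ract : right_action mulA ract;
  mp_lact : left_action mulV lact;
  mp1 : forall (a : A) (x : V),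
    a ⋅ (x ▷ a ⋅ a) + ((x ◁ a ⋅ a) ▷ a)
    = (a ⋅ a) ⋅ (x ▷ a) + ((x ◁ a) ▷ a ⋅ a);
  mp2 : forall (a : A) (x : V),
    (x ◁ (x ⋆ x ▷ a)) + (x ⋆ x ◁ a) ⋆ x
    = (x ⋆ x ◁ (x ▷ a)) + (x ⋆ x) ⋆ (x ◁ a);
  mp3 : forall (a b : A) (x : V),
    ((((x ◁ a) ◁ b) ◁ a) + (x ◁ (x ▷ a) ⋅ b) + (x ◁ ((x ◁ a) ▷ b))
      + ((x ◁ a) ◁ b) ⋆ x) *+ 2
    + ((x ⋆ x ◁ b) ◁ a) + (x ◁ b ⋅ (a ⋅ a))
    = (((x ◁ a) ◁ b ⋅ a) + ((x ◁ a) ◁ (x ▷ b)) + ((x ◁ b) ◁ (x ▷ a))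
      + (x ◁ a) ⋆ (x ◁ b)) *+ 2
    + (x ⋆ x ◁ b ⋅ a) + ((x ◁ b) ◁ a ⋅ a);
  mp4 : forall (a : A) (x y : V),
    ((y ▷ (x ▷ a)) ⋅ a + (x ▷ (y ▷ (x ▷ a))) + ((y ◁ (x ▷ a)) ▷ a)
      + ((x ◁ a) ⋆ y ▷ a)) *+ 2
    + ((x ⋆ x) ⋆ y ▷ a) + (x ▷ (y ▷ a ⋅ a))
    = ((y ▷ a) ⋅ (x ▷ a) + (x ⋆ y ▷ (x ▷ a)) + ((y ◁ a) ▷ (x ▷ a))
      + ((x ◁ a) ▷ (y ▷ a))) *+ 2
    + (x ⋆ x ▷ (y ▷ a)) + (x ⋆ y ▷ a ⋅ a);
  mp5 : forall (a : A) (x y : V),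
    (((y ◁ (x ▷ a)) ◁ a) + ((x ◁ a) ⋆ y ◁ a) + (x ◁ (y ▷ (x ▷ a)))
      + (y ◁ (x ▷ a)) ⋆ x + ((x ◁ a) ⋆ y) ⋆ x) *+ 2
    + ((x ⋆ x) ⋆ y ◁ a) + (x ◁ (y ▷ a ⋅ a)) + (y ◁ a ⋅ a) ⋆ x
    = (((x ◁ a) ◁ (y ▷ a)) + ((y ◁ a) ◁ (x ▷ a)) + (x ⋆ y ◁ (x ▷ a))
      + (x ◁ a) ⋆ (x ⋆ y) + (x ◁ a) ⋆ (y ◁ a)) *+ 2
    + (x ⋆ x ◁ (y ▷ a)) + (x ⋆ y ◁ a ⋅ a) + (x ⋆ x) ⋆ (y ◁ a);
  mp6 : forall (a b : A) (x : V),
    (((x ▷ a) ⋅ b) ⋅ a + ((x ◁ a) ▷ b) ⋅ a + (((x ◁ a) ◁ b) ▷ a)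
      + (x ▷ (x ▷ a) ⋅ b) + (x ▷ ((x ◁ a) ▷ b))) *+ 2
    + (x ⋆ x ▷ b) ⋅ a + ((x ⋆ x ◁ b) ▷ a) + (x ▷ (a ⋅ a) ⋅ b)
    = ((x ▷ a) ⋅ (a ⋅ b) + ((x ◁ a) ▷ b ⋅ a) + (x ▷ a) ⋅ (x ▷ b)
      + ((x ◁ b) ▷ (x ▷ a)) + ((x ◁ a) ▷ (x ▷ b))) *+ 2
    + (x ⋆ x ▷ b ⋅ a) + ((x ◁ b) ▷ a ⋅ a) + (a ⋅ a) ⋅ (x ▷ b)
}.

Definition bicrossed_mul (p q : A * V) : A * V :=
  let: (a, x) := p in
  let: (b, y) := q in
  (a ⋅ b + (x ▷ b) + (y ▷ a), (x ◁ b) + (y ◁ a) + x ⋆ y).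

End MatchedPair.

(* Main.v *)
Require Import Defs.
From mathcomp Require Import all_boot all_algebra.

Import GRing.Theory.
Local Open Scope ring_scope.

(** The multiplication is bilinear and commutative on A × V, so only the Jordan
identity (p²q)p = p²(qp) matters. It is additive in q, hence may be tested on
q = (b, 0) and q = (0, y). With p = (a, x) and q = (b, 0), the component of
degree 3 in a is the Jordan identity of A and the one of degree 3 in x is (MP2)
together with the left action axiom; all the remaining mixed terms add up to
(MP3) in V and (MP6) in A. For q = (0, y), one gets in the same way (MP1), the
right action axiom, (MP5) and (MP4). *)

Section Bilinear.

Context {k : fieldType} {U W M : lmodType k} {f : U -> W -> M}.
Hypothesis f_bilinear : bilinear_map f.

Lemma bilinearDl u u' w : f (u + u') w = f u w + f u' w.
Proof. by have := f_bilinear.1 w 1 u u'; rewrite /= !scale1r. Qed.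

Lemma bilinearDr u w w' : f u (w + w') = f u w + f u w'.
Proof. by have := f_bilinear.2 u 1 w w'; rewrite /= !scale1r. Qed.

Lemma bilinear0l w : f 0 w = 0.
Proof. by apply: (addrI (f 0 w)); rewrite -bilinearDl !addr0. Qed.

Lemma bilinear0r u : f u 0 = 0.
Proof. by apply: (addrI (f u 0)); rewrite -bilinearDr !addr0. Qed.

Lemma bilinearM2l u w : f (u *+ 2) w = f u w *+ 2.
Proof. by rewrite !mulr2n bilinearDl. Qed.

Lemma bilinearM2r u w : f u (w *+ 2) = f u w *+ 2.
Proof. by rewrite !mulr2n bilinearDr. Qed.

Lemma bilinearZl c u w : f (c *: u) w = c *: f u w.
Proof. by have := f_bilinear.1 w c u 0; rewrite /= bilinear0l !addr0. Qed.

Lemma bilinearZr c u w : f u (c *: w) = c *: f u w.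
Proof. by have := f_bilinear.2 u c w 0; rewrite /= bilinear0r !addr0. Qed.

Definition bilinearE :=
  (bilinearDl, bilinearDr, bilinearM2l, bilinearM2r, bilinear0l, bilinear0r).

End Bilinear.

Lemma pair_eq_iff (S T : Type) (s s' : S) (t t' : T) (P Q : Prop) :
  (s = s' <-> P) -> (t = t' <-> Q) -> (s, t) = (s', t') <-> P /\ Q.
Proof. by move=> [sP Ps] [tQ Qt]; split=> [[/sP ? /tQ] | [/Ps -> /Qt ->]]. Qed.

(** Serves to strip from an expanded identity [l = r] a part [e = e'] already known, so that the
    equivalence concerns only the remaining terms. *)
Lemma eq_addr_cancel {U : zmodType} {e e' l r l' r' : U} :
  e = e' -> l = l' + e -> r = r' + e' -> l = r <-> l' = r'.
Proof. by move=> -> -> ->; split=> [/addIr | ->]. Qed.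

(* The coefficient 2 is generalized because [addrA] would otherwise see through
   [x *+ 2] as [x + x]. *)
Ltac addr_perm :=
  generalize 2%N => ?; rewrite ?addrA;
  repeat match goal with
  | |- _ + ?t = _ =>
      try rewrite [in RHS](addrC t); repeat rewrite [in RHS](addrAC _ t);
      congr (_ + t)
  end.

Section BicrossedProduct.

Variables (k : fieldType) (A V : lmodType k).
Variables (mulA : A -> A -> A) (mulV : V -> V -> V).
Variables (ract : V -> A -> V) (lact : V -> A -> A).
Hypotheses (jordanA : jordan_algebra mulA) (jordanV : jordan_algebra mulV).
Hypotheses (ract_bilinear : bilinear_map ract)
           (lact_bilinear : bilinear_map lact).

Local Notation "a ⋅ b" := (mulA a b) (at level 40, left associativity).
Local Notation "x ⋆ y" := (mulV x y) (at level 40, left associativity).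
Local Notation "x ◁ a" := (ract x a) (at level 45, no associativity).
Local Notation "x ▷ a" := (lact x a) (at level 45, no associativity).
Local Notation "p ∘ q" := (bicrossed_mul mulA mulV ract lact p q)
  (at level 40, left associativity).

Let mulA_bilinear : bilinear_map mulA. Proof. by case: jordanA. Qed.
Let mulV_bilinear : bilinear_map mulV. Proof. by case: jordanV. Qed.
Let mulAC : commutative mulA. Proof. by case: jordanA. Qed.
Let mulVC : commutative mulV. Proof. by case: jordanV. Qed.
Let mulAJ a b : ((a ⋅ a) ⋅ b) ⋅ a = (a ⋅ a) ⋅ (b ⋅ a).
Proof. by case: jordanA. Qed.
Let mulVJ x y : ((x ⋆ x) ⋆ y) ⋆ x = (x ⋆ x) ⋆ (y ⋆ x).
Proof. by case: jordanV. Qed.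

Let expand := (bilinearE mulA_bilinear,
  bilinearE mulV_bilinear, bilinearE ract_bilinear,
  bilinearE lact_bilinear).

Local Notation jordan_at p q := (((p ∘ p) ∘ q) ∘ p = (p ∘ p) ∘ (q ∘ p)).

(** The two cross terms of a square coincide; collected as [*+ 2], they are the source of the
    factors 2 in (MP3)-(MP6). *)
Lemma bicrossed_sqr a x :
  (a, x) ∘ (a, x) = (a ⋅ a + (x ▷ a) *+ 2, (x ◁ a) *+ 2 + x ⋆ x).
Proof. by rewrite /bicrossed_mul /= !mulr2n !addrA. Qed.

Lemma bicrossed_mulC : commutative (bicrossed_mul mulA mulV ract lact).
Proof.
move=> [a x] [b y]; rewrite /bicrossed_mul /= mulAC mulVC.
by rewrite addrAC (addrC (x ◁ b)).
Qed.

Lemma bicrossed_mul_bilinear :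
  bilinear_map (bicrossed_mul mulA mulV ract lact).
Proof.
have linl q : GRing.linear_for *:%R (bicrossed_mul mulA mulV ract lact ^~ q).
  move=> c [a x] [a' x']; case: q => [b y].
  rewrite /bicrossed_mul /=; congr (_, _).
  - rewrite !expand !(bilinearZl mulA_bilinear,
      bilinearZl lact_bilinear, bilinearZr lact_bilinear).
    (* The right side is a projection of a linear combination of pairs; conversion turns it into
       that combination of components. *)
    by rewrite -[RHS]/(_ *: (_ + _) + _) !scalerDr; addr_perm.
  - rewrite !expand !(bilinearZl mulV_bilinear,
      bilinearZl ract_bilinear, bilinearZr ract_bilinear).
    by rewrite -[RHS]/(_ *: (_ + _) + _) !scalerDr; addr_perm.
split=> // p c q r; rewrite !(bicrossed_mulC p); exact: linl.
Qed.

Lemma jordan_atD p q r : jordan_at p q -> jordan_at p r -> jordan_at p (q + r).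
Proof.
by move=> Jq Jr; rewrite !(bilinearE bicrossed_mul_bilinear) Jq Jr.
Qed.

(** Isolates the part free of [x] in the identity at [(a, x)] and [(0, y)]. *)
Lemma jordan_at_A0V a y :
  jordan_at (a, 0) (0, y) <->
  a ⋅ (y ▷ a ⋅ a) + ((y ◁ a ⋅ a) ▷ a)
    = (a ⋅ a) ⋅ (y ▷ a) + ((y ◁ a) ▷ a ⋅ a)
  /\ ((y ◁ a ⋅ a) ◁ a) = ((y ◁ a) ◁ a ⋅ a).
Proof.
rewrite /bicrossed_mul /= !expand !(mul0rn, add0r, addr0) (mulAC a).
by split=> [[] | [-> ->]].
Qed.

Lemma jordan_at_V0A b x :
  jordan_at (0, x) (b, 0) <->
  (x ▷ (x ⋆ x ▷ b)) = (x ⋆ x ▷ (x ▷ b))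
  /\ (x ◁ (x ⋆ x ▷ b)) + (x ⋆ x ◁ b) ⋆ x
    = (x ⋆ x ◁ (x ▷ b)) + (x ⋆ x) ⋆ (x ◁ b).
Proof.
rewrite /bicrossed_mul /= !expand !(mul0rn, add0r, addr0).
by split=> [[] | [-> ->]].
Qed.

(** The hypothesis carries the terms free of [a]. The terms of degrees 1 and 2 in [a] stay together
    in one equation per component, just as in (MP6) and (MP3). *)
Lemma jordan_at_A a x b :
  jordan_at (0, x) (b, 0) ->
  jordan_at (a, x) (b, 0) <->
  (((x ▷ a) ⋅ b) ⋅ a + ((x ◁ a) ▷ b) ⋅ a + (((x ◁ a) ◁ b) ▷ a)
      + (x ▷ (x ▷ a) ⋅ b) + (x ▷ ((x ◁ a) ▷ b))) *+ 2
    + (x ⋆ x ▷ b) ⋅ a + ((x ⋆ x ◁ b) ▷ a) + (x ▷ (a ⋅ a) ⋅ b)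
    = ((x ▷ a) ⋅ (a ⋅ b) + ((x ◁ a) ▷ b ⋅ a) + (x ▷ a) ⋅ (x ▷ b)
      + ((x ◁ b) ▷ (x ▷ a)) + ((x ◁ a) ▷ (x ▷ b))) *+ 2
    + (x ⋆ x ▷ b ⋅ a) + ((x ◁ b) ▷ a ⋅ a) + (a ⋅ a) ⋅ (x ▷ b)
  /\ ((((x ◁ a) ◁ b) ◁ a) + (x ◁ (x ▷ a) ⋅ b) + (x ◁ ((x ◁ a) ▷ b))
      + ((x ◁ a) ◁ b) ⋆ x) *+ 2
    + ((x ⋆ x ◁ b) ◁ a) + (x ◁ b ⋅ (a ⋅ a))
    = (((x ◁ a) ◁ b ⋅ a) + ((x ◁ a) ◁ (x ▷ b)) + ((x ◁ b) ◁ (x ▷ a))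
      + (x ◁ a) ⋆ (x ◁ b)) *+ 2
    + (x ⋆ x ◁ b ⋅ a) + ((x ◁ b) ◁ a ⋅ a).
Proof.
move=> /jordan_at_V0A [lactJ mp2].
rewrite bicrossed_sqr /bicrossed_mul /= !expand !(mul0rn, addr0, add0r).
rewrite !mulrnDl.
apply: pair_eq_iff.
(* Two known equations, of degree 3 in [a] and in [x], are added and cancelled at once. *)
- apply: (eq_addr_cancel (f_equal2 +%R (mulAJ a b) lactJ)).
  + by addr_perm.
  + by rewrite (mulAC a b); addr_perm.
(* [A × 0] is closed under the product, so the V-component has no term of degree 3 in [a]. *)
- apply: (eq_addr_cancel mp2).
  + by rewrite (mulAC b (a ⋅ a)); addr_perm.
  + by addr_perm.
Qed.

Lemma jordan_at_V a x y :
  jordan_at (a, 0) (0, y) ->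
  jordan_at (a, x) (0, y) <->
  ((y ▷ (x ▷ a)) ⋅ a + (x ▷ (y ▷ (x ▷ a))) + ((y ◁ (x ▷ a)) ▷ a)
      + ((x ◁ a) ⋆ y ▷ a)) *+ 2
    + ((x ⋆ x) ⋆ y ▷ a) + (x ▷ (y ▷ a ⋅ a))
    = ((y ▷ a) ⋅ (x ▷ a) + (x ⋆ y ▷ (x ▷ a)) + ((y ◁ a) ▷ (x ▷ a))
      + ((x ◁ a) ▷ (y ▷ a))) *+ 2
    + (x ⋆ x ▷ (y ▷ a)) + (x ⋆ y ▷ a ⋅ a)
  /\ (((y ◁ (x ▷ a)) ◁ a) + ((x ◁ a) ⋆ y ◁ a) + (x ◁ (y ▷ (x ▷ a)))
      + (y ◁ (x ▷ a)) ⋆ x + ((x ◁ a) ⋆ y) ⋆ x) *+ 2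
    + ((x ⋆ x) ⋆ y ◁ a) + (x ◁ (y ▷ a ⋅ a)) + (y ◁ a ⋅ a) ⋆ x
    = (((x ◁ a) ◁ (y ▷ a)) + ((y ◁ a) ◁ (x ▷ a)) + (x ⋆ y ◁ (x ▷ a))
      + (x ◁ a) ⋆ (x ⋆ y) + (x ◁ a) ⋆ (y ◁ a)) *+ 2
    + (x ⋆ x ◁ (y ▷ a)) + (x ⋆ y ◁ a ⋅ a) + (x ⋆ x) ⋆ (y ◁ a).
Proof.
move=> /jordan_at_A0V [mp1 ractJ].
rewrite bicrossed_sqr /bicrossed_mul /= !expand !(mul0rn, addr0, add0r).
rewrite !mulrnDl.
apply: pair_eq_iff.
(* [0 × V] is closed under the product, so the A-component has no term of degree 3 in [x]. *)
- apply: (eq_addr_cancel mp1).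
  + by rewrite (mulAC a); addr_perm.
  + by rewrite (mulVC y x) (mulAC (x ▷ a)); addr_perm.
- apply: (eq_addr_cancel (f_equal2 +%R (mulVJ x y) ractJ)).
  + by addr_perm.
  + by rewrite (mulVC y x); addr_perm.
Qed.

Lemma bicrossed_jordanP :
  jordan_algebra (bicrossed_mul mulA mulV ract lact) <->
  matched_pair mulA mulV ract lact.
Proof.
split=> [[_ _ J] | MP].
  have JA a b x := (jordan_at_A a x b (J _ _)).1 (J _ _).
  have JV a x y := (jordan_at_V a x y (J _ _)).1 (J _ _).
  have JA0 a y := (jordan_at_A0V a y).1 (J _ _).
  have JV0 b x := (jordan_at_V0A b x).1 (J _ _).
  (* The two action axioms and (MP1)-(MP6) are exactly the eight conjuncts of the four facts above;
     [apply] picks the right conjunct. *)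
  by split=> //; try split=> //; move=> *;
    (apply JA || apply JV || apply JA0 || apply JV0).
split; [exact: bicrossed_mul_bilinear | exact: bicrossed_mulC |].
case: MP => _ _ [_ ractJ] [_ lactJ] mp1 mp2 mp3 mp4 mp5 mp6 [a x] [b y].
have -> : (b, y) = (b, 0) + (0, y) :> A * V.
  by congr (_, _); rewrite ?addr0 ?add0r.
apply: jordan_atD.
- by apply/jordan_at_A => //; apply/jordan_at_V0A.
- by apply/jordan_at_V => //; apply/jordan_at_A0V.
Qed.

End BicrossedProduct.

Theorem theorem2p2 (k : fieldType) (chark : 2%N \notin [pchar k])
    (A V : lmodType k) (mulA : A -> A -> A) (mulV : V -> V -> V)
    (jordanA : jordan_algebra mulA) (jordanV : jordan_algebra mulV)
    (ract : V -> A -> V) (lact : V -> A -> A)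
    (ract_bilinear : bilinear_map ract) (lact_bilinear : bilinear_map lact) :
  jordan_algebra (bicrossed_mul mulA mulV ract lact) <->
  matched_pair mulA mulV ract lact.
Proof. exact: bicrossed_jordanP. Qed.
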